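(* Let $q$ be a prime power, $m,k,t$ positive integers, $\mathbf{n}=(n_1,\dots,n_t)$ with $n_1\ge\cdots\ge n_t\ge1$, $N=n_1+\cdots+n_t$, and let $\mathcal{U}=(\mathcal{U}_1,\dots,\mathcal{U}_t)$ be an $[\mathbf{n},k]_{q^m/q}$ system with generator matrix $G=[G_1|\cdots|G_t]$. Let $\mathcal{C}\subseteq\mathbb{F}_{q^m}^N$ be the $\mathbb{F}_{q^m}$-linear code spanned by the rows of $G$ (the code associated to $\mathcal{U}$), and let $\mathcal{C}^\perp=\{x\in\mathbb{F}_{q^m}^N: Gx^T=0\}$. Let $\rho$ be a positive integer. Then $\mathcal{U}$ is sum-rank $\rho$-saturating if and only if $\rho_{\mathrm{srk}}(\mathcal{C}^\perp)=\rho$.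
   Context: An $[\mathbf{n},k]_{q^m/q}$ system is a tuple $(\mathcal{U}_1,\dots,\mathcal{U}_t)$ of $\mathbb{F}_q$-subspaces of $\mathbb{F}_{q^m}^k$ with $\dim_{\mathbb{F}_q}\mathcal{U}_i=n_i$ whose union spans $\mathbb{F}_{q^m}^k$ over $\mathbb{F}_{q^m}$. A generator matrix is $G=[G_1|\cdots|G_t]$ with $G_i\in\mathbb{F}_{q^m}^{k\times n_i}$ whose columns span $\mathcal{U}_i$ over $\mathbb{F}_q$. For an $\mathbb{F}_q$-subspace $W\le\mathbb{F}_{q^m}^k$, $L_W=\{\langle u\rangle_{\mathbb{F}_{q^m}}:u\in W\setminus\{0\}\}\subseteq\mathrm{PG}(k-1,q^m)$. A point set $\mathcal{S}$ is $r$-saturating if every point of $\mathrm{PG}(k-1,q^m)$ lies in the $\mathbb{F}_{q^m}$-span of some $r+1$ points of $\mathcal{S}$ and $r$ is minimal with this property; $\mathcal{U}$ is sum-rank $\rho$-saturating if $L_{\mathcal{U}_1}\cup\cdots\cup L_{\mathcal{U}_t}$ is $(\rho-1)$-saturating. Write $\mathbb{F}_{q^m}^N=\mathbb{F}_{q^m}^{n_1}\oplus\cdots\oplus\mathbb{F}_{q^m}^{n_t}$; for $x=(x_1,\dots,x_t)$, the sum-rank weight is $w(x)=\sum_i\mathrm{rk}(x_i)$, where $\mathrm{rk}(x_i)$ is the $\mathbb{F}_q$-dimension of the $\mathbb{F}_q$-span of the entries of $x_i$, and $d(x,y)=w(x-y)$. The sum-rank covering radius of a code $\mathcal{D}\subseteq\mathbb{F}_{q^m}^N$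 is $\rho_{\mathrm{srk}}(\mathcal{D})=\max_{x\in\mathbb{F}_{q^m}^N}\min_{c\in\mathcal{D}}d(x,c)$. *)

(* Defs.v *)
From HB Require Import structures.
From mathcomp Require Import all_boot all_order all_algebra all_field.

Set Implicit Arguments.
Unset Strict Implicit.
Unset Printing Implicit Defensive.

Import GRing.Theory.
Local Open Scope ring_scope.

(* Throughout, F is the field with q = #|F| elements and L its extension of
   degree m = \dim {:L}.  The space L^k occurs in two forms: as
   {ffun 'I_k -> L}, which carries the library's F-vector space structure, and
   as 'cV[L]_k, which carries the L-vector space structure. *)

Definition ffun_col (L : Type) (k : nat) (u : {ffun 'I_k -> L}) : 'cV[L]_k :=
  \col_r u r.

Definition col_ffun (L : Type) (k n : nat) (A : 'M[L]_(k, n)) (j : 'I_n) :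
  {ffun 'I_k -> L} := [ffun r => A r j].

Section Systems.

Variables (F : finFieldType) (L : fieldExtType F) (k t : nat).
Variable n : 'I_t -> nat.
Implicit Type U : 'I_t -> {vspace {ffun 'I_k -> L}}.

Definition is_system U : Prop :=
  (forall i, \dim (U i) = n i) /\
  (forall V : {vspace 'cV[L]_k},
     (forall i u, u \in U i -> ffun_col u \in V) -> V = fullv).

Definition is_generator_matrix U (G : forall i, 'M[L]_(k, n i)) : Prop :=
  forall i, U i = <<[seq col_ffun (G i) j | j : 'I_(n i)]>>%VS.

(* The points of PG(k-1, q^m) are the V : {vspace 'cV[L]_k} with \dim V = 1. *)
Definition linear_set (W : {vspace {ffun 'I_k -> L}})
    (P : {vspace 'cV[L]_k}) : Prop :=
  exists u, [/\ u \in W, u != 0 & P = <[ffun_col u]>%VS].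

Definition covers_with (S : {vspace 'cV[L]_k} -> Prop) (r : nat) : Prop :=
  forall P : {vspace 'cV[L]_k}, \dim P = 1%N ->
    exists s : seq {vspace 'cV[L]_k},
      [/\ size s = r.+1, uniq s, forall Q, Q \in s -> S Q
        & (P <= \sum_(Q <- s) Q)%VS].

Definition saturating (S : {vspace 'cV[L]_k} -> Prop) (r : nat) : Prop :=
  covers_with S r /\ (forall r', covers_with S r' -> (r <= r')%N).

Definition sum_rank_saturating U (rho : nat) : Prop :=
  saturating (fun P => exists i, linear_set (U i) P) rho.-1.

Definition rk_weight (l : nat) (x : 'rV[L]_l) : nat :=
  \dim <<[seq x ord0 j | j : 'I_l]>>%VS.

Definition srk_weight (x : 'rV[L]_(\sum_i n i)) : nat :=
  (\sum_(i < t) rk_weight (submxrow x i))%N.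

Definition srk_dist (x y : 'rV[L]_(\sum_i n i)) : nat := srk_weight (x - y).

Lemma srk_dist_le (x y : 'rV[L]_(\sum_i n i)) :
  (srk_dist x y <= \sum_i n i)%N.
Proof.
apply: leq_sum => i _; apply: leq_trans (dim_span _) _.
by rewrite size_map size_enum_ord.
Qed.

(* finvect_type L is L with its finite type structure.  By srk_dist_le, the
   default value of the minimum does not affect it when D is nonempty. *)
Definition srk_covering_radius (D : pred 'rV[L]_(\sum_i n i)) : nat :=
  (\max_(x : 'rV[finvect_type L]_(\sum_i n i))
     \big[minn/(\sum_i n i)]_(c : 'rV[finvect_type L]_(\sum_i n i) | D c)
       srk_dist x c)%N.

End Systems.

Definition row_code (L : fieldType) (k N : nat) (G : 'M[L]_(k, N)) :
  {vspace 'rV[L]_N} := <<[seq row i G | i : 'I_k]>>%VS.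

Definition dual_code (L : fieldType) (k N : nat) (G : 'M[L]_(k, N)) :
  pred 'rV[L]_N := fun x => G *m x^T == 0.

(* dual_code G depends only on the code spanned by the rows of G. *)
Lemma dual_codeP (L : fieldType) (k N : nat) (G : 'M[L]_(k, N)) (x : 'rV_N) :
  reflect (forall c, c \in row_code G -> c *m x^T = 0) (dual_code G x).
Proof.
apply: (iffP eqP) => [Gx0 c | Cx0].
  rewrite /row_code -[X in <<X>>%VS]in_tupleE => /coord_span ->.
  rewrite mulmx_suml big1 // => i _; rewrite -scalemxAl.
  have /imageP[j _ ->] : (in_tuple [seq row j G | j : 'I_k])`_i
      \in [seq row j G | j : 'I_k] by rewrite mem_nth.
  by rewrite -row_mul Gx0 row0 scaler0.
apply/row_matrixP => i; rewrite row_mul row0 Cx0 //.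
by apply: memv_span; apply: image_f.
Qed.

(* Main.v *)
Require Import Defs.
From HB Require Import structures.
From mathcomp Require Import all_boot all_order all_algebra all_field.

Import GRing.Theory.
Local Open Scope ring_scope.

(** Up to the action of [G], a vector [x] of sum-rank weight [w] is the same
    thing as an expression of [v = G x^T] as an [L]-combination of [w] vectors
    of the union of the [U i]: expand each block of [x] over an [F]-basis of the
    span of its entries.  Since [G] is surjective, the covering radius is
    therefore the least [R] such that every [v] lies in the span of at most [R]
    points.  To get exactly [R] distinct points, note that a coset whose minimal
    weight is [R] produces [R] points of the set, which must be distinct by
    minimality, so there are always enough points to pad with. *)

(** * Finite minima and lists of subspaces *)

Lemma bigminn_le (I : finType) (P : pred I) (f : I -> nat) (d : nat) (i : I) :
  P i -> (\big[minn/d]_(j | P j) f j <= f i)%N.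
Proof.
move=> Pi; have := mem_index_enum i; elim: (index_enum I) => //= j r IHr.
rewrite inE big_cons => /predU1P[<- | /IHr le_r]; first by rewrite Pi geq_minl.
by case: ifP => // _; apply: leq_trans le_r; apply: geq_minr.
Qed.

(** The fold equals either the default [d] or some [f i]. In the first case [f i0 <= d] makes [i0]
    itself a minimiser, so the default is harmless. *)
Lemma bigminn_attained (I : finType) (P : pred I) (f : I -> nat) (d : nat)
    (i0 : I) :
  P i0 -> (f i0 <= d)%N ->
  exists2 i, P i & \big[minn/d]_(j | P j) f j = f i.
Proof.
move=> Pi0 le_d.
have : \big[minn/d]_(j | P j) f j = d \/
       exists2 i, P i & \big[minn/d]_(j | P j) f j = f i.
  apply: (big_ind (fun a => a = d \/ exists2 i, P i & a = f i)); first by left.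
    by move=> a b Ha Hb; rewrite /minn; case: ifP.
  by move=> i Pi; right; exists i.
case=> // min_d; exists i0 => //; apply/eqP.
by rewrite eqn_leq bigminn_le // min_d.
Qed.

(** Serves to reach the exact number of distinct points demanded by [covers_with]: at least
    [size s0 - size s] elements of [s0] lie outside [s], and these fill it up. *)
Lemma uniq_pad (T : eqType) (s s0 : seq T) :
  uniq s -> uniq s0 -> (size s <= size s0)%N ->
  exists s1, [/\ size s1 = size s0, uniq s1, {subset s <= s1}
                & {subset s1 <= s ++ s0}].
Proof.
move=> Us Us0 le_s; set p := [seq x <- s0 | x \notin s].
have le_p : (size s0 - size s <= size p)%N.
  rewrite leq_subLR -size_cat; apply: uniq_leq_size => // x xs0.
  by rewrite mem_cat mem_filter xs0 andbT orbN.
exists (s ++ take (size s0 - size s) p); split.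
- by rewrite size_cat size_takel // subnKC.
- rewrite cat_uniq Us take_uniq ?filter_uniq // andbT /=.
  by apply/hasPn => x /mem_take; rewrite mem_filter => /andP[].
- by move=> x xs; rewrite mem_cat xs.
- move=> x; rewrite !mem_cat => /orP[-> // | /mem_take].
  by rewrite mem_filter => /andP[_ ->]; rewrite orbT.
Qed.

Lemma sumv_subset (K : fieldType) (vT : vectType K) (s s1 : seq {vspace vT}) :
  {subset s <= s1} -> (\sum_(Q <- s) Q <= \sum_(Q <- s1) Q)%VS.
Proof.
move=> ss1; elim: s ss1 => [|Q s IHs] ss1; first by rewrite big_nil sub0v.
rewrite big_cons subv_add IHs; last by move=> x xs; rewrite ss1 ?inE ?xs ?orbT.
have Qs1 : Q \in s1 by rewrite ss1 ?mem_head.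
by rewrite (big_rem Q) //= addvSl.
Qed.

(** * Column spans over [F] and subadditivity of the weights *)

Lemma colspanP (F : finFieldType) (L : fieldExtType F) (k l : nat)
    (A : 'M[L]_(k, l)) (u : {ffun 'I_k -> L}) :
  u \in <<[seq col_ffun A j | j : 'I_l]>>%VS <->
  exists c : 'I_l -> F, ffun_col u = A *m \col_j (c j)%:A.
Proof.
have colE (c : 'I_l -> F) :
    ffun_col (\sum_j c j *: col_ffun A j) = A *m \col_j (c j)%:A.
  apply/colP => r; rewrite !mxE sum_ffunE; apply: eq_bigr => j _.
  by rewrite !ffunE mxE -scalerAr mulr1.
rewrite span_def big_image /=; split=> [/memv_sumP[vs vsP ->] | [c cE]].
  have /fin_all_exists[c cP] (j : 'I_l) : exists a, vs j = a *: col_ffun A j.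
    by have /vlineP := vsP j isT.
  by exists c; rewrite -colE; congr ffun_col; apply: eq_bigr.
apply/memv_sumP; exists (fun j => c j *: col_ffun A j).
  by move=> j _; rewrite memvZ ?memv_line.
apply/ffunP => r; move/colP/(_ r): cE; rewrite -colE !mxE.
by move=> ->.
Qed.

Lemma rk_weight_add (F : finFieldType) (L : fieldExtType F) (l : nat)
    (x y : 'rV[L]_l) :
  (rk_weight (x + y) <= rk_weight x + rk_weight y)%N.
Proof.
apply: leq_trans (dimvS _) (dimv_add_leqif _ _).
apply/span_subvP => _ /imageP[j _ ->]; rewrite mxE.
by apply: memv_add; apply: memv_span; apply: image_f.
Qed.

Lemma rk_weight0 (F : finFieldType) (L : fieldExtType F) (l : nat) :
  rk_weight (0 : 'rV[L]_l) = 0%N.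
Proof.
apply/eqP; rewrite dimv_eq0 -subv0; apply/span_subvP => _ /imageP[j _ ->].
by rewrite mxE mem0v.
Qed.

Lemma rk_weight_scale (F : finFieldType) (L : fieldExtType F) (l : nat)
    (a : L) (c : 'I_l -> F) :
  (rk_weight (\row_j (c j *: a)) <= 1)%N.
Proof.
apply: (@leq_trans (\dim <[a]>)); last by rewrite dim_vline leq_b1.
apply: dimvS; apply/span_subvP => _ /imageP[j _ ->].
by rewrite mxE memvZ ?memv_line.
Qed.

Lemma srk_weight_add (F : finFieldType) (L : fieldExtType F) (t : nat)
    (n : 'I_t -> nat) (x y : 'rV[L]_(\sum_i n i)) :
  (srk_weight (x + y) <= srk_weight x + srk_weight y)%N.
Proof.
rewrite -big_split; apply: leq_sum => i _.
by rewrite submxrowD rk_weight_add.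
Qed.

Lemma srk_weight0 (F : finFieldType) (L : fieldExtType F) (t : nat)
    (n : 'I_t -> nat) : srk_weight (0 : 'rV[L]_(\sum_i n i)) = 0%N.
Proof. by apply: big1 => i _; rewrite submxrow0 rk_weight0. Qed.

(** * Syndromes and spans of points *)

Lemma mul_mxrow_tr (L : fieldType) (k t : nat) (n : 'I_t -> nat)
    (G : forall i, 'M[L]_(k, n i)) (x : 'rV[L]_(\sum_i n i)) :
  \mxrow_i G i *m x^T = \sum_i G i *m (submxrow x i)^T.
Proof.
rewrite -{1}[x]submxrowK tr_mxrow mul_mxrow_mxcol.
by apply: eq_bigr => i _.
Qed.

Lemma block_syndrome_points (F : finFieldType) (L : fieldExtType F) (k l : nat)
    (A : 'M[L]_(k, l)) (y : 'rV[L]_l) :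
  exists s : seq {vspace 'cV[L]_k},
    [/\ (size s <= rk_weight y)%N,
        forall Q, Q \in s ->
          linear_set <<[seq col_ffun A j | j : 'I_l]>>%VS Q
      & A *m y^T \in (\sum_(Q <- s) Q)%VS].
Proof.
set V := <<[seq y ord0 j | j : 'I_l]>>%VS; pose b := vbasis V.
(* The [e]-th coordinates of the entries of [y] lie in [F], so [u e] is in the [F]-span of the
   columns of [A]; the [e]-th basis vector becomes its coefficient in [L]. *)
pose u (e : 'I_(\dim V)) : 'cV[L]_k :=
  A *m \col_j (coord b e (y ord0 j))%:A.
have yE j : y ord0 j = \sum_(e < \dim V) coord b e (y ord0 j) *: b`_e.
  by apply: coord_vbasis; apply: memv_span; apply: image_f.
have AyE : A *m y^T = \sum_(e < \dim V) b`_e *: u e.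
  apply/colP => r; rewrite summxE mxE.
  transitivity (\sum_j \sum_(e < \dim V) b`_e * (A r j * (coord b e (y ord0 j))%:A)).
    apply: eq_bigr => j _; rewrite mxE {1}yE mulr_sumr; apply: eq_bigr => e _.
    by rewrite -!scalerAr mulr1 mulrC.
  rewrite exchange_big; apply: eq_bigr => e _; rewrite !mxE mulr_sumr.
  by apply: eq_bigr => j _; rewrite mxE.
(* A zero [u e] defines no point and is dropped, so only an upper bound on the size remains. *)
exists [seq <[u e]>%VS | e <- [seq e <- enum 'I_(\dim V) | u e != 0]]; split.
- rewrite size_map size_filter; apply: leq_trans (count_size _ _) _.
  by rewrite size_enum_ord.
- move=> Q /mapP[e]; rewrite mem_filter => /andP[ue0 _] ->.
  have uE : ffun_col [ffun r => u e r 0] = u e.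
    by apply/colP => r; rewrite mxE ffunE.
  exists [ffun r => u e r 0]; split; last by rewrite uE.
    by apply/colspanP; exists (fun j => coord b e (y ord0 j)).
  apply: contraNneq ue0 => u0; rewrite -uE u0; apply/eqP/colP => r.
  by rewrite !mxE ffunE.
rewrite big_map big_filter AyE big_enum_cond /=.
apply: memv_suml => e _; case: (eqVneq (u e) 0) => [-> | ue0].
  by rewrite scaler0 mem0v.
rewrite (bigD1 e) //=; apply: (subvP (addvSl _ _)).
by rewrite memvZ ?memv_line.
Qed.

Section Syndromes.

Context {F : finFieldType} {L : fieldExtType F} {k t : nat} {n : 'I_t -> nat}.
Context {U : 'I_t -> {vspace {ffun 'I_k -> L}}} {G : forall i, 'M[L]_(k, n i)}.
Hypothesis genG : is_generator_matrix U G.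

Let points (P : {vspace 'cV[L]_k}) : Prop := exists i, linear_set (U i) P.

Lemma syndrome_points (x : 'rV[L]_(\sum_i n i)) :
  exists s : seq {vspace 'cV[L]_k},
    [/\ (size s <= srk_weight x)%N, uniq s, forall Q, Q \in s -> points Q
      & \mxrow_i G i *m x^T \in (\sum_(Q <- s) Q)%VS].
Proof.
have /fin_all_exists[s sP] i := block_syndrome_points _ _ _ _ (G i) (submxrow x i).
(* Points may coincide, within a block or across blocks; removing repetitions keeps every line and
   hence the span. *)
exists (undup (flatten [seq s i | i <- index_enum 'I_t])); split.
- apply: leq_trans (size_undup _) _.
  rewrite size_flatten /shape sumnE 2!big_map /=; apply: leq_sum => i _.
  by have [] := sP i.
- exact: undup_uniq.
- move=> Q; rewrite mem_undup => /flatten_mapP[i _ Qs]; exists i.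
  by have [_ + _] := sP i; rewrite -genG; apply.
rewrite mul_mxrow_tr; apply: memv_suml => i _.
have [_ _] := sP i; apply: subvP; apply: sumv_subset => Q Qs.
by rewrite mem_undup; apply/flatten_mapP; exists i; rewrite ?mem_index_enum.
Qed.

Lemma line_syndrome (i : 'I_t) (u : {ffun 'I_k -> L}) (a : L) :
  u \in U i ->
  exists2 x : 'rV[L]_(\sum_i n i),
    (srk_weight x <= 1)%N & \mxrow_i G i *m x^T = a *: ffun_col u.
Proof.
rewrite genG => /colspanP[c cE].
(* Block [i] carries the [F]-coordinates of [u] multiplied by [a], and all other blocks vanish. The
   cast only reconciles the types when [j = i]. *)
pose B j : 'rV[L]_(n j) :=
  if j =P i is ReflectT e then
    castmx (erefl, esym (congr1 n e)) (\row_j (c j *: a)) else 0.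
have Bi : B i = \row_j (c j *: a).
  rewrite /B; case: eqP => // e; rewrite (eq_irrelevance (esym _) erefl).
  exact: castmx_id.
have Bj j : j != i -> B j = 0 by rewrite /B; case: eqP.
exists (\mxrow_j B j).
  rewrite /srk_weight (bigD1 i) //= mxrowK Bi big1 ?addn0 ?rk_weight_scale //.
  by move=> j ji; rewrite mxrowK Bj ?rk_weight0.
rewrite mul_mxrow_tr (bigD1 i) //= mxrowK Bi big1 ?addr0; last first.
  by move=> j ji; rewrite mxrowK Bj // trmx0 mulmx0.
rewrite cE scalemxAr; congr (_ *m _); apply/colP => j.
by rewrite !mxE -scalerAr mulr1.
Qed.

(** Each line contributes a vector of weight at most one by [line_syndrome], and subadditivity of
    the weight bounds their sum. *)
Lemma points_syndrome (s : seq {vspace 'cV[L]_k}) (v : 'cV[L]_k) :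
  (forall Q, Q \in s -> points Q) -> v \in (\sum_(Q <- s) Q)%VS ->
  exists2 x : 'rV[L]_(\sum_i n i),
    (srk_weight x <= size s)%N & \mxrow_i G i *m x^T = v.
Proof.
elim: s v => [|Q s IHs] v sP.
  rewrite big_nil memv0 => /eqP ->.
  by exists 0; rewrite ?srk_weight0 // trmx0 mulmx0.
rewrite big_cons => /memv_addP[v1 v1Q [v2 v2s ->]].
have [x2 wx2 Gx2] : exists2 x : 'rV[L]_(\sum_i n i),
    (srk_weight x <= size s)%N & \mxrow_i G i *m x^T = v2.
  by apply: IHs => // Q' Q's; apply: sP; rewrite inE Q's orbT.
have [i [u [uU _ QE]]] := sP Q (mem_head _ _).
have /vlineP[a v1E] : v1 \in <[ffun_col u]>%VS by rewrite -QE.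
have [x1 wx1 Gx1] := line_syndrome i u a uU.
exists (x1 + x2).
  by apply: leq_trans (srk_weight_add _ _ _ _ _ _) _; apply: leq_add wx1 wx2.
by rewrite linearD mulmxDr Gx1 Gx2 v1E.
Qed.

(** * Covering radius and saturation *)

Hypothesis sysU : is_system n U.

(** The image of the syndrome map is an [L]-subspace containing every [U i], so the spanning
    condition of a system makes it everything. *)
Lemma syndrome_surj (v : 'cV[L]_k) :
  exists x : 'rV[L]_(\sum_i n i), \mxrow_i G i *m x^T = v.
Proof.
pose f : 'Hom('cV[L]_(\sum_i n i), 'cV[L]_k) := linfun (mulmx (\mxrow_i G i)).
have imf : limg f = fullv.
  apply: sysU.2 => i u /(line_syndrome i u 1)[x _ Gx].
  by apply/memv_imgP; exists x^T; rewrite ?memvf // lfunE /= Gx scale1r.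
have /memv_imgP[y _ ->] : v \in limg f by rewrite imf memvf.
by exists y^T; rewrite trmxK lfunE.
Qed.

Let R := srk_covering_radius (dual_code (\mxrow_i G i)).

(** The substitution [z = x - c] turns codewords [c] into the vectors with the syndrome of [x], so
    the distance from [x] to the dual code is the least weight in its coset. *)
Lemma coset_min (x : 'rV[L]_(\sum_i n i)) :
  let d := \big[minn/(\sum_i n i)%N]_(c : 'rV[finvect_type L]_(\sum_i n i)
             | dual_code (\mxrow_i G i) c) srk_dist x c in
  (exists2 z : 'rV[L]_(\sum_i n i),
     \mxrow_i G i *m z^T = \mxrow_i G i *m x^T & srk_weight z = d) /\
  (forall z : 'rV[L]_(\sum_i n i),
     \mxrow_i G i *m z^T = \mxrow_i G i *m x^T -> (d <= srk_weight z)%N).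
Proof.
move=> d; split.
  have [||c Dc dE] := @bigminn_attained _
      (fun c : 'rV[finvect_type L]_(\sum_i n i) => dual_code (\mxrow_i G i) c)
      (fun c => srk_dist x c) (\sum_i n i)%N 0.
  - by rewrite /dual_code trmx0 mulmx0.
  - exact: srk_dist_le.
  exists (x - c); last by rewrite /d dE.
  by rewrite linearB mulmxBr (eqP Dc) subr0.
move=> z Gz.
have -> : srk_weight z = srk_dist x (x - z) by rewrite /srk_dist opprB addrC subrK.
apply: (@bigminn_le _
  (fun c : 'rV[finvect_type L]_(\sum_i n i) => dual_code (\mxrow_i G i) c)).
by rewrite /dual_code linearB mulmxBr Gz subrr.
Qed.

Lemma covering_radius_le (B : nat) :
  (forall v : 'cV[L]_k, exists2 z : 'rV[L]_(\sum_i n i),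
     (srk_weight z <= B)%N & \mxrow_i G i *m z^T = v) -> (R <= B)%N.
Proof.
move=> le_B; apply/bigmax_leqP => x _.
have [z wz Gz] := le_B (\mxrow_i G i *m x^T).
exact: leq_trans ((coset_min x).2 z Gz) wz.
Qed.

Lemma syndrome_of_weight_le_radius (v : 'cV[L]_k) :
  exists2 z : 'rV[L]_(\sum_i n i),
    (srk_weight z <= R)%N & \mxrow_i G i *m z^T = v.
Proof.
have [x <-] := syndrome_surj v.
have [[z Gz wz] _] := coset_min x; exists z => //; rewrite wz.
exact: (@leq_bigmax _ (fun x : 'rV[finvect_type L]_(\sum_i n i) => _) x).
Qed.

Lemma exists_radius_points :
  exists s : seq {vspace 'cV[L]_k},
    [/\ size s = R, uniq s & forall Q, Q \in s -> points Q].
Proof.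
have [|x RE] := @eq_bigmax 'rV[finvect_type L]_(\sum_i n i)
  (fun x => \big[minn/(\sum_i n i)%N]_(c : 'rV[finvect_type L]_(\sum_i n i)
             | dual_code (\mxrow_i G i) c) srk_dist x c).
  by apply/card_gt0P; exists 0.
have [[z Gz wz] minz] := coset_min x.
have [s [le_s Us sP Gs]] := syndrome_points z.
exists s; split=> //; apply/eqP; rewrite eqn_leq; apply/andP; split.
  by rewrite /R /srk_covering_radius RE -wz.
(* The points give back a vector [y] of the same coset, so fewer than [R] of them would beat the
   coset minimum. *)
have [y wy Gy] := points_syndrome s _ sP Gs.
by apply: leq_trans wy; rewrite /R /srk_covering_radius RE; apply: minz; rewrite Gy.
Qed.

(** Weight zero yields an empty list of points, which cannot span the all-ones vector. Positivity
    makes [R.-1] a true predecessor. *)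
Lemma covering_radius_gt0 : (0 < k)%N -> (0 < R)%N.
Proof.
move=> k0; rewrite lt0n; apply/eqP => R0.
have [z] := syndrome_of_weight_le_radius (const_mx 1); rewrite R0 leqn0 => /eqP wz.
have [s [+ _ _]] := syndrome_points z.
rewrite wz leqn0 => /nilP -> + Gz; rewrite Gz big_nil memv0 => /eqP/colP.
by move/(_ (Ordinal k0))/eqP; rewrite !mxE oner_eq0.
Qed.

Lemma covers_with_radius : (0 < R)%N -> covers_with points R.-1.
Proof.
move=> R0 P dimP; have [z wz Gz] := syndrome_of_weight_le_radius (vpick P).
have [s [le_s Us sP Gs]] := syndrome_points z.
have [s0 [sz0 Us0 s0P]] := exists_radius_points.
have [|s1 [sz1 Us1 ss1 s1P]] := uniq_pad _ s s0 Us Us0.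
  by rewrite sz0; apply: leq_trans wz.
exists s1; split=> //; first by rewrite sz1 sz0 prednK.
  by move=> Q /s1P; rewrite mem_cat => /orP[/sP | /s0P].
have /eqP <- : (<[vpick P]> == P)%VS.
  by rewrite eqEdim dim_vline vpick0 -dimv_eq0 dimP -memvE memv_pick.
rewrite -memvE -Gz; exact: subvP (sumv_subset _ _ _ _ ss1) _ Gs.
Qed.

Lemma radius_le_covers_with (r : nat) : covers_with points r -> (R <= r.+1)%N.
Proof.
(* The zero vector spans no projective point, so [cov] says nothing about it; it is the syndrome of
   [0]. *)
move=> cov; apply: covering_radius_le => v; have [-> | v0] := eqVneq v 0.
  by exists 0; rewrite ?srk_weight0 // trmx0 mulmx0.
have [|s [sz _ sP Ps]] := cov <[v]>%VS; first by rewrite dim_vline v0.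
by rewrite -sz; apply: points_syndrome; rewrite // memvE.
Qed.

End Syndromes.

Theorem theorem2p5 (F : finFieldType) (L : fieldExtType F) (k t : nat)
  (hk : (0 < k)%N) (ht : (0 < t)%N)
  (n : 'I_t -> nat)
  (hn_mono : forall i j : 'I_t, (i <= j)%N -> (n j <= n i)%N)
  (hn_pos : forall i, (0 < n i)%N)
  (U : 'I_t -> {vspace {ffun 'I_k -> L}}) (hU : is_system n U)
  (G : forall i, 'M[L]_(k, n i)) (hG : is_generator_matrix U G)
  (rho : nat) (hrho : (0 < rho)%N) :
  sum_rank_saturating U rho <->
  srk_covering_radius (dual_code (\mxrow_i G i)) = rho.
Proof.
have R0 := covering_radius_gt0 hG hU hk.
have covR := covers_with_radius hG hU R0.
split=> [[cov min] | <-].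
  (* Covering with [rho] points bounds the radius by [rho]; minimality of [rho.-1] against the
     covering [covR] gives the converse. Both numbers being positive, no predecessor is
     truncated. *)
  apply/eqP; rewrite eqn_leq; apply/andP; split.
    by rewrite -(prednK hrho); apply: radius_le_covers_with.
  by rewrite -(prednK hrho) -(prednK R0) ltnS; apply: min.
split=> // r /(radius_le_covers_with hG).
by rewrite -{1}(prednK R0) ltnS.
Qed.
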